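(* Let $A=(a_{ij})_{i,j\in I}$ be a matrix satisfying (B1)–(B3), let $J=\{i\in I: a_{ii}>0\}$, and assume that $a_{ij}<0$ whenever $i,j\in I\setminus J$ and $i\ne j$. Let $V'=\coprod_{i\in I\setminus J}U(\mathfrak n_J^-)\cdot f_i$ and let $G_J$ be the Kac–Moody group of $\mathfrak g_J$ relative to $T(V')$. Let $S_1'$ and $S_2'$ be distinct bases of $V'$, and let $G_1=G(S_1')\rtimes G_J$ and $G_2=G(S_2')\rtimes G_J$. Then $G_1$ and $G_2$ are isomorphic.
   Context: Let $\mathbb K\subset\mathbb C$ be a subfield, $I$ a countable index set, and $A=(a_{ij})_{i,j\in I}$ a matrix with entries in $\mathbb K$ (real, as the inequalities below presuppose) such that: (B1) $A$ is symmetric; (B2) $a_{ij}\le 0$ if $i\ne j$; (B3) if $a_{ii}>0$ then $2a_{ij}/a_{ii}\in\mathbb Z$ for all $j\in I$. The Borcherds algebra $\mathfrak g$ of $A$ is the Lie algebra over $\mathbb K$ with generators $h_i,e_i,f_i$ ($i\in I$) and relations: $[h_i,h_j]=0$; $[h_i,e_k]=a_{ik}e_k$; $[h_i,f_k]=-a_{ik}f_k$; $[e_i,f_j]=\delta_{ij}h_i$; $(\mathrm{ad}\,e_i)^{-2a_{ij}/a_{ii}+1}e_j=0=(\mathrm{ad}\,f_i)^{-2a_{ij}/a_{ii}+1}f_j$ for $i\ne j$ with $a_{ii}>0$; $[e_i,e_j]=0=[f_i,f_j]$ whenever $a_{ij}=0$. The root lattice is $Q=\bigoplus_{i\in I}\mathbb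 Z\alpha_i$, with bilinear form $(\alpha_i,\alpha_j)=a_{ij}$; $\mathfrak g$ is $Q$-graded by $\deg e_i=\alpha_i$, $\deg f_i=-\alpha_i$, $\deg h_i=0$. $\mathfrak g_J$ is the subalgebra generated by $e_i,f_i$ ($i\in J$), which is the Kac–Moody (or semi-simple) algebra of $(a_{ij})_{i,j\in J}$; $\mathfrak n_J^-$ is the subalgebra generated by the $f_i$, $i\in J$. The real roots $\Delta_J^{\mathrm{re}}$ of $\mathfrak g_J$ are the images of the $\alpha_j$ ($j\in J$) under the Weyl group generated by the reflections $\beta\mapsto\beta-\frac{2(\beta,\alpha_j)}{a_{jj}}\alpha_j$, $j\in J$. $V'=\coprod_{i\in I\setminus J}U(\mathfrak n_J^-)\cdot f_i$, where $U(\mathfrak n_J^-)$ (universal enveloping algebra) acts on $\mathfrak g$ by the adjoint action and $\coprod$ is direct sum; each summand is an integrable highest weight $\mathfrak g_J$-module. The adjoint action of $\mathfrak g_J$ on $V'$ extends by derivations to a representation $\pi:\mathfrak g_J\to\mathfrak{gl}(T(V'))$ on the tensor algebra $T(V')=\bigoplus_{n\ge0}T^n(V')$. Root vectors $x_\alpha\in(\mathfrak g_J)_\alpha$, $\alpha\in\Delta_J^{\mathrm{re}}$, act locally nilpotently. Let $\widehat G_J=*_{\alpha\in\Delta_J^{\mathrm{re}}}(\mathfrak g_J)_\alpha$ be the free product of the additive groups $(\mathfrak g_J)_\alpha$, let $\widehat\pi:\widehat G_J\to GL(T(V'))$ be the homomorphism given by $x_\alpha\mapsto\exp(\pi(x_\alpha))$,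 and let $G_J=\widehat G_J/\ker\widehat\pi$; thus $G_J$ is identified with the subgroup of $GL(T(V'))$ generated by all $\exp(\pi(x_\alpha))$. For a basis $S'$ of $V'$, view the elements of $S'$ as non-commuting formal variables, let $A(S')$ be the free associative algebra over $\mathbb K$ on $S'$, graded by word length, and let $\Psi_{S'}:T(V')\to A(S')$ be the graded algebra isomorphism sending each basis vector to the corresponding variable. The action of $G_J$ on $T(V')$ is transferred to $A(S')$ via $\Psi_{S'}$. Let $\widehat A(S')=\prod_{n\ge0}A_n(S')$, and let $\widehat L(S')\subset\widehat A(S')$ be the Lie subalgebra of series $\sum_{n\ge1}u_n$ with $u_n\in L_n(S')$, the degree-$n$ part of the free Lie algebra $L(S')\subset A(S')$. The Magnus group is $G(S')=\exp(\widehat L(S'))$, a group under multiplication in $\widehat A(S')$. The group $G_J$ acts on $\widehat A(S')$ degreewise, $g\cdot\sum_n u_n=\sum_n g\cdot u_n$, and this restricts to an action on $G(S')$ by group automorphisms. $G(S')\rtimes G_J$ is the semi-direct product for this action, with multiplication $(n_1,g_1)(n_2,g_2)=(n_1\cdot(g_1\cdot n_2),g_1g_2)$. *)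

(* Defs.v *)
From HB Require Import structures.
From mathcomp Require Import all_boot all_order all_algebra generic_quotient.
From mathcomp Require Import boolp classical_sets functions cardinality reals.
From mathcomp Require Import complex finmap monalg.
Set Implicit Arguments.
Unset Strict Implicit.
Unset Printing Implicit Defensive.
Import Order.TTheory GRing.Theory Num.Theory.
Local Open Scope quotient_scope.
Local Open Scope classical_set_scope.
Local Open Scope ring_scope.

(** * Lie algebras given by generators and relations

  Formal Lie expressions in generators [X], modulo the smallest congruence
  that contains [rel] and the axioms of a Lie algebra over [K]. *)

Section LiePresentation.
Variables (K : fieldType) (X : Type).

Inductive lie_term : Type :=
| LGen of X
| LZero
| LAdd of lie_term & lie_term
| LScale of K & lie_term
| LBr of lie_term & lie_term.

HB.instance Definition _ := gen_eqMixin lie_term.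
HB.instance Definition _ := gen_choiceMixin lie_term.

Variable rel : lie_term -> lie_term -> Prop.

Inductive lie_eq : lie_term -> lie_term -> Prop :=
| le_rel s t : rel s t -> lie_eq s t
| le_refl s : lie_eq s s
| le_sym s t : lie_eq s t -> lie_eq t s
| le_trans s t u : lie_eq s t -> lie_eq t u -> lie_eq s u
| le_add s s' t t' :
    lie_eq s s' -> lie_eq t t' -> lie_eq (LAdd s t) (LAdd s' t')
| le_scale c s s' : lie_eq s s' -> lie_eq (LScale c s) (LScale c s')
| le_br s s' t t' : lie_eq s s' -> lie_eq t t' -> lie_eq (LBr s t) (LBr s' t')
| le_addA s t u : lie_eq (LAdd s (LAdd t u)) (LAdd (LAdd s t) u)
| le_addC s t : lie_eq (LAdd s t) (LAdd t s)
| le_add0 s : lie_eq (LAdd LZero s) s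
| le_addN s : lie_eq (LAdd (LScale (-1) s) s) LZero
| le_scaleA c d s : lie_eq (LScale c (LScale d s)) (LScale (c * d) s)
| le_scale1 s : lie_eq (LScale 1 s) s
| le_scaleDr c s t :
    lie_eq (LScale c (LAdd s t)) (LAdd (LScale c s) (LScale c t))
| le_scaleDl c d s :
    lie_eq (LScale (c + d) s) (LAdd (LScale c s) (LScale d s))
| le_brDl s t u : lie_eq (LBr (LAdd s t) u) (LAdd (LBr s u) (LBr t u))
| le_brDr s t u : lie_eq (LBr s (LAdd t u)) (LAdd (LBr s t) (LBr s u))
| le_brZl c s t : lie_eq (LBr (LScale c s) t) (LScale c (LBr s t))
| le_brZr c s t : lie_eq (LBr s (LScale c t)) (LScale c (LBr s t))
| le_br_alt s : lie_eq (LBr s s) LZero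
| le_jacobi s t u :
    lie_eq (LAdd (LBr s (LBr t u)) (LAdd (LBr t (LBr u s)) (LBr u (LBr s t))))
           LZero.

Lemma lie_eq_equiv : equiv_class_of (fun s t => `[< lie_eq s t >]).
Proof.
split=> [s|s t|t s u].
- exact/asboolP/le_refl.
- by apply/asboolP/asboolP => /le_sym.
- by move=> /asboolP st /asboolP tu; apply/asboolP/(le_trans st).
Qed.
Canonical lie_eq_rel := EquivRelPack lie_eq_equiv.

Definition lie_pres : Type := {eq_quot lie_eq_rel}.
HB.instance Definition _ := Choice.on lie_pres.
HB.instance Definition _ := EqQuotient.on lie_pres.

Definition lie_pi (s : lie_term) : lie_pres := \pi_lie_pres s.
Definition lie_gen (x : X) : lie_pres := lie_pi (LGen x).

Lemma lie_piP s t : lie_pi s = lie_pi t <-> lie_eq s t.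
Proof.
rewrite /lie_pi; split=> [/eqmodP/asboolP//|st].
by apply/eqmodP/asboolP.
Qed.

Lemma lie_piK s : lie_eq (repr (lie_pi s)) s.
Proof. by apply/lie_piP; rewrite /lie_pi reprK. Qed.

Lemma lie_pi_ex (x : lie_pres) : exists s, x = lie_pi s.
Proof. by exists (repr x); rewrite /lie_pi reprK. Qed.

Let add (x y : lie_pres) := lie_pi (LAdd (repr x) (repr y)).
Let opp (x : lie_pres) := lie_pi (LScale (-1) (repr x)).
Let scale c (x : lie_pres) := lie_pi (LScale c (repr x)).
Definition lie_br (x y : lie_pres) : lie_pres :=
  lie_pi (LBr (repr x) (repr y)).

Let addE s t : add (lie_pi s) (lie_pi t) = lie_pi (LAdd s t).
Proof. by apply/lie_piP/le_add; exact: lie_piK. Qed.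
Let oppE s : opp (lie_pi s) = lie_pi (LScale (-1) s).
Proof. by apply/lie_piP/le_scale; exact: lie_piK. Qed.
Let scaleE c s : scale c (lie_pi s) = lie_pi (LScale c s).
Proof. by apply/lie_piP/le_scale; exact: lie_piK. Qed.
Lemma lie_brE s t : lie_br (lie_pi s) (lie_pi t) = lie_pi (LBr s t).
Proof. by apply/lie_piP/le_br; exact: lie_piK. Qed.

Let addA : associative add.
Proof.
move=> x y z; have [s ->] := lie_pi_ex x; have [t ->] := lie_pi_ex y.
by have [u ->] := lie_pi_ex z; rewrite !addE; apply/lie_piP/le_addA.
Qed.
Let addC : commutative add.
Proof.
move=> x y; have [s ->] := lie_pi_ex x; have [t ->] := lie_pi_ex y.
by rewrite !addE; apply/lie_piP/le_addC.
Qed.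
Let add0 : left_id (lie_pi LZero) add.
Proof.
by move=> x; have [s ->] := lie_pi_ex x; rewrite addE; apply/lie_piP/le_add0.
Qed.
Let addN : left_inverse (lie_pi LZero) opp add.
Proof.
move=> x; have [s ->] := lie_pi_ex x.
by rewrite oppE addE; apply/lie_piP/le_addN.
Qed.
HB.instance Definition _ := GRing.isZmodule.Build lie_pres addA addC add0 addN.

Let scaleA c d x : scale c (scale d x) = scale (c * d) x.
Proof.
by have [s ->] := lie_pi_ex x; rewrite !scaleE; apply/lie_piP/le_scaleA.
Qed.
Let scale1 : left_id 1 scale.
Proof.
by move=> x; have [s ->] := lie_pi_ex x; rewrite scaleE; apply/lie_piP/le_scale1.
Qed.
Let scaleDr : right_distributive scale add.
Proof.
move=> c x y; have [s ->] := lie_pi_ex x; have [t ->] := lie_pi_ex y.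
by rewrite addE !scaleE addE; apply/lie_piP/le_scaleDr.
Qed.
Let scaleDl x : {morph scale^~ x : c d / c + d}.
Proof.
move=> c d; have [s ->] := lie_pi_ex x.
by rewrite !scaleE [RHS]addE; apply/lie_piP/le_scaleDl.
Qed.
HB.instance Definition _ := GRing.Zmodule_isLmodule.Build K lie_pres
  scaleA scale1 scaleDr scaleDl.

Lemma lie_pi0 : lie_pi LZero = 0. Proof. by []. Qed.
Lemma lie_piD s t : lie_pi (LAdd s t) = lie_pi s + lie_pi t.
Proof. by rewrite -addE. Qed.
Lemma lie_piZ c s : lie_pi (LScale c s) = c *: lie_pi s.
Proof. by rewrite -scaleE. Qed.

Lemma lie_brDl x y z : lie_br (x + y) z = lie_br x z + lie_br y z.
Proof.
have [s ->] := lie_pi_ex x; have [t ->] := lie_pi_ex y.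
have [u ->] := lie_pi_ex z.
by rewrite -lie_piD !lie_brE -lie_piD; apply/lie_piP/le_brDl.
Qed.
Lemma lie_brDr x y z : lie_br x (y + z) = lie_br x y + lie_br x z.
Proof.
have [s ->] := lie_pi_ex x; have [t ->] := lie_pi_ex y.
have [u ->] := lie_pi_ex z.
by rewrite -lie_piD !lie_brE -lie_piD; apply/lie_piP/le_brDr.
Qed.
Lemma lie_brZl c x y : lie_br (c *: x) y = c *: lie_br x y.
Proof.
have [s ->] := lie_pi_ex x; have [t ->] := lie_pi_ex y.
by rewrite -lie_piZ !lie_brE -lie_piZ; apply/lie_piP/le_brZl.
Qed.
Lemma lie_brZr c x y : lie_br x (c *: y) = c *: lie_br x y.
Proof.
have [s ->] := lie_pi_ex x; have [t ->] := lie_pi_ex y.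
by rewrite -lie_piZ !lie_brE -lie_piZ; apply/lie_piP/le_brZr.
Qed.
Lemma lie_brxx x : lie_br x x = 0.
Proof.
by have [s ->] := lie_pi_ex x; rewrite lie_brE; apply/lie_piP/le_br_alt.
Qed.
Lemma lie_jacobi x y z :
  lie_br x (lie_br y z) + (lie_br y (lie_br z x) + lie_br z (lie_br x y)) = 0.
Proof.
have [s ->] := lie_pi_ex x; have [t ->] := lie_pi_ex y.
have [u ->] := lie_pi_ex z.
by rewrite !lie_brE -!lie_piD; apply/lie_piP/le_jacobi.
Qed.

Lemma lie_br0 x : lie_br x 0 = 0.
Proof. by rewrite -(scale0r (0 : lie_pres)) lie_brZr !scale0r. Qed.
Lemma lie_0br x : lie_br 0 x = 0.
Proof. by rewrite -(scale0r (0 : lie_pres)) lie_brZl !scale0r. Qed.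
Lemma lie_brC x y : lie_br x y = - lie_br y x.
Proof.
have := lie_brxx (x + y).
rewrite lie_brDl !lie_brDr !lie_brxx add0r addr0 => /eqP.
by rewrite addr_eq0 => /eqP.
Qed.
Lemma lie_br_der x y z :
  lie_br x (lie_br y z) = lie_br (lie_br x y) z + lie_br y (lie_br x z).
Proof.
apply/eqP; rewrite -subr_eq0 -(lie_jacobi x y z) opprD; apply/eqP.
congr (_ + _); rewrite addrC; congr (_ + _).
  by rewrite (lie_brC x z) -scaleN1r lie_brZr scaleN1r opprK.
by rewrite [RHS]lie_brC.
Qed.

End LiePresentation.

Arguments LGen {K X}.
Arguments LZero {K X}.
Arguments LAdd {K X}.
Arguments LScale {K X}.
Arguments LBr {K X}.
Arguments lie_gen {K X rel}.
Arguments lie_br {K X rel}.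

(** * Associative unital algebras given by generators and relations *)

Section AlgPresentation.
Variables (K : fieldType) (X : Type).

Inductive alg_term : Type :=
| AGen of X
| AZero
| AAdd of alg_term & alg_term
| AScale of K & alg_term
| AOne
| AMul of alg_term & alg_term.

HB.instance Definition _ := gen_eqMixin alg_term.
HB.instance Definition _ := gen_choiceMixin alg_term.

Variable rel : alg_term -> alg_term -> Prop.

Inductive alg_eq : alg_term -> alg_term -> Prop :=
| ae_rel s t : rel s t -> alg_eq s t
| ae_refl s : alg_eq s s
| ae_sym s t : alg_eq s t -> alg_eq t s
| ae_trans s t u : alg_eq s t -> alg_eq t u -> alg_eq s u
| ae_add s s' t t' :
    alg_eq s s' -> alg_eq t t' -> alg_eq (AAdd s t) (AAdd s' t')
| ae_scale c s s' : alg_eq s s' -> alg_eq (AScale c s) (AScale c s')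
| ae_mul s s' t t' :
    alg_eq s s' -> alg_eq t t' -> alg_eq (AMul s t) (AMul s' t')
| ae_addA s t u : alg_eq (AAdd s (AAdd t u)) (AAdd (AAdd s t) u)
| ae_addC s t : alg_eq (AAdd s t) (AAdd t s)
| ae_add0 s : alg_eq (AAdd AZero s) s
| ae_addN s : alg_eq (AAdd (AScale (-1) s) s) AZero
| ae_scaleA c d s : alg_eq (AScale c (AScale d s)) (AScale (c * d) s)
| ae_scale1 s : alg_eq (AScale 1 s) s
| ae_scaleDr c s t :
    alg_eq (AScale c (AAdd s t)) (AAdd (AScale c s) (AScale c t))
| ae_scaleDl c d s :
    alg_eq (AScale (c + d) s) (AAdd (AScale c s) (AScale d s))
| ae_mulA s t u : alg_eq (AMul s (AMul t u)) (AMul (AMul s t) u)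
| ae_mul1l s : alg_eq (AMul AOne s) s
| ae_mul1r s : alg_eq (AMul s AOne) s
| ae_mulDl s t u : alg_eq (AMul (AAdd s t) u) (AAdd (AMul s u) (AMul t u))
| ae_mulDr s t u : alg_eq (AMul s (AAdd t u)) (AAdd (AMul s t) (AMul s u))
| ae_mulZl c s t : alg_eq (AMul (AScale c s) t) (AScale c (AMul s t))
| ae_mulZr c s t : alg_eq (AMul s (AScale c t)) (AScale c (AMul s t)).

Lemma alg_eq_equiv : equiv_class_of (fun s t => `[< alg_eq s t >]).
Proof.
split=> [s|s t|t s u].
- exact/asboolP/ae_refl.
- by apply/asboolP/asboolP => /ae_sym.
- by move=> /asboolP st /asboolP tu; apply/asboolP/(ae_trans st).
Qed.
Canonical alg_eq_rel := EquivRelPack alg_eq_equiv.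

Definition alg_pres : Type := {eq_quot alg_eq_rel}.
HB.instance Definition _ := Choice.on alg_pres.
HB.instance Definition _ := EqQuotient.on alg_pres.

Definition alg_pi (s : alg_term) : alg_pres := \pi_alg_pres s.
Definition alg_gen (x : X) : alg_pres := alg_pi (AGen x).

Lemma alg_piP s t : alg_pi s = alg_pi t <-> alg_eq s t.
Proof.
rewrite /alg_pi; split=> [/eqmodP/asboolP//|st].
by apply/eqmodP/asboolP.
Qed.

Lemma alg_piK s : alg_eq (repr (alg_pi s)) s.
Proof. by apply/alg_piP; rewrite /alg_pi reprK. Qed.

Lemma alg_pi_ex (x : alg_pres) : exists s, x = alg_pi s.
Proof. by exists (repr x); rewrite /alg_pi reprK. Qed.

Let add (x y : alg_pres) := alg_pi (AAdd (repr x) (repr y)).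
Let opp (x : alg_pres) := alg_pi (AScale (-1) (repr x)).
Let scale c (x : alg_pres) := alg_pi (AScale c (repr x)).
Let mul (x y : alg_pres) := alg_pi (AMul (repr x) (repr y)).

Let addE s t : add (alg_pi s) (alg_pi t) = alg_pi (AAdd s t).
Proof. by apply/alg_piP/ae_add; exact: alg_piK. Qed.
Let oppE s : opp (alg_pi s) = alg_pi (AScale (-1) s).
Proof. by apply/alg_piP/ae_scale; exact: alg_piK. Qed.
Let scaleE c s : scale c (alg_pi s) = alg_pi (AScale c s).
Proof. by apply/alg_piP/ae_scale; exact: alg_piK. Qed.
Let mulE s t : mul (alg_pi s) (alg_pi t) = alg_pi (AMul s t).
Proof. by apply/alg_piP/ae_mul; exact: alg_piK. Qed.

Let addA : associative add.
Proof.
move=> x y z; have [s ->] := alg_pi_ex x; have [t ->] := alg_pi_ex y.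
by have [u ->] := alg_pi_ex z; rewrite !addE; apply/alg_piP/ae_addA.
Qed.
Let addC : commutative add.
Proof.
move=> x y; have [s ->] := alg_pi_ex x; have [t ->] := alg_pi_ex y.
by rewrite !addE; apply/alg_piP/ae_addC.
Qed.
Let add0 : left_id (alg_pi AZero) add.
Proof.
by move=> x; have [s ->] := alg_pi_ex x; rewrite addE; apply/alg_piP/ae_add0.
Qed.
Let addN : left_inverse (alg_pi AZero) opp add.
Proof.
move=> x; have [s ->] := alg_pi_ex x.
by rewrite oppE addE; apply/alg_piP/ae_addN.
Qed.
HB.instance Definition _ := GRing.isZmodule.Build alg_pres addA addC add0 addN.

Let scaleA c d x : scale c (scale d x) = scale (c * d) x.
Proof.
by have [s ->] := alg_pi_ex x; rewrite !scaleE; apply/alg_piP/ae_scaleA.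
Qed.
Let scale1 : left_id 1 scale.
Proof.
by move=> x; have [s ->] := alg_pi_ex x; rewrite scaleE; apply/alg_piP/ae_scale1.
Qed.
Let scaleDr : right_distributive scale add.
Proof.
move=> c x y; have [s ->] := alg_pi_ex x; have [t ->] := alg_pi_ex y.
by rewrite addE !scaleE addE; apply/alg_piP/ae_scaleDr.
Qed.
Let scaleDl x : {morph scale^~ x : c d / c + d}.
Proof.
move=> c d; have [s ->] := alg_pi_ex x.
by rewrite !scaleE [RHS]addE; apply/alg_piP/ae_scaleDl.
Qed.
HB.instance Definition _ := GRing.Zmodule_isLmodule.Build K alg_pres
  scaleA scale1 scaleDr scaleDl.

Let mulA : associative mul.
Proof.
move=> x y z; have [s ->] := alg_pi_ex x; have [t ->] := alg_pi_ex y.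
by have [u ->] := alg_pi_ex z; rewrite !mulE; apply/alg_piP/ae_mulA.
Qed.
Let mul1l : left_id (alg_pi AOne) mul.
Proof.
by move=> x; have [s ->] := alg_pi_ex x; rewrite mulE; apply/alg_piP/ae_mul1l.
Qed.
Let mul1r : right_id (alg_pi AOne) mul.
Proof.
by move=> x; have [s ->] := alg_pi_ex x; rewrite mulE; apply/alg_piP/ae_mul1r.
Qed.
Let mulDl : left_distributive mul add.
Proof.
move=> x y z; have [s ->] := alg_pi_ex x; have [t ->] := alg_pi_ex y.
have [u ->] := alg_pi_ex z; rewrite addE !mulE addE.
exact/alg_piP/ae_mulDl.
Qed.
Let mulDr : right_distributive mul add.
Proof.
move=> x y z; have [s ->] := alg_pi_ex x; have [t ->] := alg_pi_ex y.
have [u ->] := alg_pi_ex z; rewrite addE !mulE addE.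
exact/alg_piP/ae_mulDr.
Qed.
HB.instance Definition _ := GRing.Zmodule_isPzRing.Build alg_pres
  mulA mul1l mul1r mulDl mulDr.

Lemma alg_pi0 : alg_pi AZero = 0. Proof. by []. Qed.
Lemma alg_pi1 : alg_pi AOne = 1. Proof. by []. Qed.
Lemma alg_piD s t : alg_pi (AAdd s t) = alg_pi s + alg_pi t.
Proof. by rewrite -addE. Qed.
Lemma alg_piZ c s : alg_pi (AScale c s) = c *: alg_pi s.
Proof. by rewrite -scaleE. Qed.
Lemma alg_piM s t : alg_pi (AMul s t) = alg_pi s * alg_pi t.
Proof. by rewrite -mulE. Qed.

Lemma alg_scalerAl c (x y : alg_pres) : c *: (x * y) = (c *: x) * y.
Proof.
have [s ->] := alg_pi_ex x; have [t ->] := alg_pi_ex y.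
by rewrite -alg_piM -!alg_piZ -alg_piM; apply/alg_piP/ae_sym/ae_mulZl.
Qed.
Lemma alg_scalerAr c (x y : alg_pres) : c *: (x * y) = x * (c *: y).
Proof.
have [s ->] := alg_pi_ex x; have [t ->] := alg_pi_ex y.
by rewrite -alg_piM -!alg_piZ -alg_piM; apply/alg_piP/ae_sym/ae_mulZr.
Qed.

End AlgPresentation.

Arguments AGen {K X}.
Arguments AZero {K X}.
Arguments AAdd {K X}.
Arguments AScale {K X}.
Arguments AOne {K X}.
Arguments AMul {K X}.
Arguments alg_gen {K X rel}.

(** * Generated subalgebras, enveloping and tensor algebras *)

Inductive lie_closure (K : fieldType) (V : lmodType K) (br : V -> V -> V)
    (X : set V) : V -> Prop :=
| lc_gen x : X x -> lie_closure br X x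
| lc_zero : lie_closure br X 0
| lc_lin c x y :
    lie_closure br X x -> lie_closure br X y -> lie_closure br X (c *: x + y)
| lc_br x y :
    lie_closure br X x -> lie_closure br X y -> lie_closure br X (br x y).

Inductive group_closure (T : Type) (X : set (T -> T)) : (T -> T) -> Prop :=
| gc_gen g : X g -> group_closure X g
| gc_id : group_closure X id
| gc_comp g h :
    group_closure X g -> group_closure X h -> group_closure X (g \o h)
| gc_inv g h :
    group_closure X g -> cancel g h -> cancel h g -> group_closure X h.

Section Enveloping.
Variables (K : fieldType) (X : Type) (rel : lie_term K X -> lie_term K X -> Prop).
Local Notation g := (lie_pres rel).
Variable n : set g.

Variant env_rel : alg_term K n -> alg_term K n -> Prop :=
| er_lin c (x y z : n) : val z = c *: val x + val y ->
    env_rel (AGen z) (AAdd (AScale c (AGen x)) (AGen y))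
| er_br (x y z : n) : val z = lie_br (val x) (val y) ->
    env_rel (AGen z) (AAdd (AMul (AGen x) (AGen y))
                           (AScale (-1) (AMul (AGen y) (AGen x)))).

Definition env_alg := alg_pres env_rel.

Fixpoint ad_term (t : alg_term K n) (v : g) : g :=
  match t with
  | AGen x => lie_br (val x) v
  | AZero => 0
  | AAdd s t => ad_term s v + ad_term t v
  | AScale c s => c *: ad_term s v
  | AOne => v
  | AMul s t => ad_term s (ad_term t v)
  end.

Definition env_ad (u : env_alg) (v : g) : g := ad_term (repr u) v.

Lemma ad_term_lin t c v w :
  ad_term t (c *: v + w) = c *: ad_term t v + ad_term t w.
Proof.
elim: t v w => [x||s IHs t IHt|d s IHs||s IHs t IHt] v w //=.
- by rewrite lie_brDr lie_brZr.
- by rewrite scaler0 addr0.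
- by rewrite IHs IHt scalerDr addrACA.
- by rewrite IHs scalerDr !scalerA mulrC.
- by rewrite IHt IHs.
Qed.

Lemma ad_termD t v w : ad_term t (v + w) = ad_term t v + ad_term t w.
Proof. by rewrite -{1}[v]scale1r ad_term_lin scale1r. Qed.
Lemma ad_term0 t : ad_term t 0 = 0.
Proof. by apply: (addIr (ad_term t 0)); rewrite -ad_termD !add0r. Qed.
Lemma ad_termZ t c v : ad_term t (c *: v) = c *: ad_term t v.
Proof. by rewrite -[c *: v]addr0 ad_term_lin ad_term0 addr0. Qed.

Lemma ad_term_eq s t v : alg_eq env_rel s t -> ad_term s v = ad_term t v.
Proof.
move=> st; elim: st v => {s t} /=.
- move=> _ _ [c x y z e|x y z e] v /=; rewrite e; first by rewrite lie_brDl lie_brZl.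
  by rewrite (lie_br_der (val x)) scaleN1r addrK.
- by [].
- by move=> s t _ IH v; rewrite IH.
- by move=> s t u _ IH1 _ IH2 v; rewrite IH1 IH2.
- by move=> s s' t t' _ IH1 _ IH2 v; rewrite IH1 IH2.
- by move=> c s s' _ IH v; rewrite IH.
- by move=> s s' t t' _ IH1 _ IH2 v; rewrite IH1 IH2.
- by move=> s t u v; rewrite addrA.
- by move=> s t v; rewrite addrC.
- by move=> s v; rewrite add0r.
- by move=> s v; rewrite scaleN1r addNr.
- by move=> c d s v; rewrite scalerA.
- by move=> s v; rewrite scale1r.
- by move=> c s t v; rewrite scalerDr.
- by move=> c d s v; rewrite scalerDl.
- by [].
- by [].
- by [].
- by [].
- by move=> s t u v; rewrite ad_termD.
- by [].
- by move=> c s t v; rewrite ad_termZ.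
Qed.

Lemma env_adE t v : env_ad (alg_pi env_rel t) v = ad_term t v.
Proof. exact/ad_term_eq/alg_piK. Qed.

(* the submodule [U(n) . v] *)
Definition env_orbit (v : g) : set g := [set env_ad u v | u in setT].

Lemma env_orbitP v w : env_orbit v w <-> exists t, w = ad_term t v.
Proof.
split=> [[u _ <-]|[t ->]]; first by exists (repr u).
by exists (alg_pi env_rel t) => //; rewrite env_adE.
Qed.

Lemma env_orbit_lin v c x y :
  env_orbit v x -> env_orbit v y -> env_orbit v (c *: x + y).
Proof.
move=> /env_orbitP[s ->] /env_orbitP[t ->]; apply/env_orbitP.
by exists (AAdd (AScale c s) t).
Qed.

Lemma env_orbit0 v : env_orbit v 0.
Proof. by apply/env_orbitP; exists AZero. Qed.

End Enveloping.

Section Tensor.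
Variables (K : fieldType) (V : lmodType K).

Variant tensor_rel : alg_term K V -> alg_term K V -> Prop :=
| tr_lin c v w : tensor_rel (AGen (c *: v + w))
                            (AAdd (AScale c (AGen v)) (AGen w)).

Definition tensor := alg_pres tensor_rel.
HB.instance Definition _ := GRing.PzRing.on tensor.
HB.instance Definition _ := GRing.Lmodule.on tensor.

Definition tensor_in (v : V) : tensor := alg_gen v.

Fixpoint der_term (phi : V -> V) (t : alg_term K V) : alg_term K V :=
  match t with
  | AGen v => AGen (phi v)
  | AZero => AZero
  | AAdd s t => AAdd (der_term phi s) (der_term phi t)
  | AScale c s => AScale c (der_term phi s)
  | AOne => AZero
  | AMul s t => AAdd (AMul (der_term phi s) t) (AMul s (der_term phi t))
  end.

(* the derivation of the tensor algebra extending the linear map [phi] *)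
Definition tensor_der (phi : V -> V) (x : tensor) : tensor :=
  alg_pi tensor_rel (der_term phi (repr x)).

Lemma der_term_eq (phi : {linear V -> V}) s t : alg_eq tensor_rel s t ->
  alg_pi tensor_rel (der_term phi s) = alg_pi tensor_rel (der_term phi t).
Proof.
have E := (alg_piD, alg_piZ, alg_piM, alg_pi0, alg_pi1).
elim=> {s t} /=.
- move=> _ _ [c v w] /=; rewrite linearP.
  by apply/alg_piP/ae_rel; constructor.
- by [].
- by [].
- by move=> s t u _ -> _ ->.
- by move=> s s' t t' _ IH1 _ IH2; rewrite !E IH1 IH2.
- by move=> c s s' _ IH; rewrite !E IH.
- by move=> s s' t t' /alg_piP e1 IH1 /alg_piP e2 IH2; rewrite !E IH1 IH2 e1 e2.
- by move=> s t u; rewrite !E addrA.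
- by move=> s t; rewrite !E addrC.
- by move=> s; rewrite !E add0r.
- by move=> s; rewrite !E scaleN1r addNr.
- by move=> c d s; rewrite !E scalerA.
- by move=> s; rewrite !E scale1r.
- by move=> c s t; rewrite !E scalerDr.
- by move=> c d s; rewrite !E scalerDl.
- by move=> s t u; rewrite !E mulrDl mulrDr !mulrA addrA.
- by move=> s; rewrite !E mul0r add0r mul1r.
- by move=> s; rewrite !E mulr0 addr0 mulr1.
- by move=> s t u; rewrite !E !mulrDl addrACA.
- by move=> s t u; rewrite !E !mulrDr addrACA.
- by move=> c s t; rewrite !E -!alg_scalerAl scalerDr.
- by move=> c s t; rewrite !E -!alg_scalerAr scalerDr.
Qed.

Lemma tensor_derE (phi : {linear V -> V}) t :
  tensor_der phi (alg_pi tensor_rel t) = alg_pi tensor_rel (der_term phi t).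
Proof. exact/der_term_eq/alg_piK. Qed.

End Tensor.

(* [g] is the exponential of the locally nilpotent endomorphism [D] *)
Definition is_exp (K : fieldType) (V : lmodType K) (D g : V -> V) : Prop :=
  forall v, exists N, iter N D v = 0 /\
    g v = \sum_(k < N) (k`!%:R)^-1 *: iter k D v.

(** * Bases, free associative and free Lie algebras, Magnus groups *)

Section Magnus.
Variables (K : fieldType) (V : lmodType K) (S : set V).

Definition lincomb (c : {malg K[S]}) : V := \sum_(s <- msupp c) c@_s *: val s.

Definition is_basis : Prop :=
  (forall c, lincomb c = 0 -> c = 0) /\ (forall v, exists c, lincomb c = v).

Definition coord (v : V) : {malg K[S]} := xget 0 [set c | lincomb c = v].

Definition free_alg : Type := {malg K[{fmonom S}]}.
HB.instance Definition _ := GRing.Lalgebra.on free_alg.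

Definition fvar (s : S) : free_alg := << fmu s >>.

Definition homog (n : nat) : set free_alg :=
  [set u | forall w, w \in msupp u -> fdeg w = n].

Definition free_lie : set free_alg :=
  lie_closure (fun u v : free_alg => u * v - v * u) (range fvar).

Definition free_lie_deg (n : nat) : set free_alg := free_lie `&` homog n.

(* [Psi] is the isomorphism from the tensor algebra onto [free_alg] that maps
   each element of [S] to its variable; [Psi_inv] is its inverse.  Both are
   meant for [S] a basis. *)
Fixpoint Psi_term (t : alg_term K V) : free_alg :=
  match t with
  | AGen v => \sum_(s <- msupp (coord v)) (coord v)@_s *: fvar s
  | AZero => 0
  | AAdd s t => Psi_term s + Psi_term t
  | AScale c s => c *: Psi_term s
  | AOne => 1
  | AMul s t => Psi_term s * Psi_term t
  end.

Definition Psi (x : tensor V) : free_alg := Psi_term (repr x).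

Definition Psi_inv (u : free_alg) : tensor V :=
  \sum_(w <- msupp u) u@_w *: \prod_(s <- (w : seq S)) tensor_in (val s).

(* A sequence [u] with [u n] homogeneous of degree [n] stands for the element
   [\sum_n u n] of the degree completion of [free_alg]. *)
Definition series : Type := nat -> free_alg.

Definition completed_lie : set series :=
  [set u | u 0%N = 0 /\ forall n, (0 < n)%N -> free_lie_deg n (u n)].

Definition series_one : series := fun n => (n == 0%N)%:R.

Definition series_mul (u v : series) : series :=
  fun n => \sum_(i < n.+1) u i * v (n - i)%N.

Definition series_pow (u : series) (k : nat) : series :=
  iter k (series_mul u) series_one.

(* For [u 0 = 0], the powers [u ^ k] with [k > n] have no term of degree [n]. *)
Definition series_exp (u : series) : series :=
  fun n => \sum_(k < n.+1) (k`!%:R)^-1 *: series_pow u k n.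

Definition magnus_group : set series := series_exp @` completed_lie.

Definition series_act (g : tensor V -> tensor V) (u : series) : series :=
  fun n => Psi (g (Psi_inv (u n))).

(* The semi-direct product of [magnus_group] by a subgroup [H] of the linear
   group of the tensor algebra, and its multiplication. *)
Definition semidirect (H : set (tensor V -> tensor V)) :
    set (series * (tensor V -> tensor V)) := magnus_group `*` H.

Definition semidirect_mul (p q : series * (tensor V -> tensor V)) :=
  (series_mul p.1 (series_act p.2 q.1), p.2 \o q.2).

End Magnus.

Arguments semidirect {K V}.
Arguments semidirect_mul {K V}.

(* Isomorphism of groups whose underlying sets [G1] and [G2] are subsets of
   types that carry the multiplications [mul1] and [mul2]. *)
Definition isomorphic (T1 T2 : Type) (G1 : set T1) (mul1 : T1 -> T1 -> T1)
    (G2 : set T2) (mul2 : T2 -> T2 -> T2) : Prop :=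
  exists f : T1 -> T2, set_bij G1 G2 f /\
    forall x y, G1 x -> G1 y -> f (mul1 x y) = mul2 (f x) (f y).

(** * Borcherds algebras *)

Variant borcherds_gen (I : Type) := BH of I | BE of I | BF of I.

Section Borcherds.
Variables (R : realType) (P : pred R[i]) (K : subFieldType P) (I : countType).
Variable a : I -> I -> K.

Record borcherds_matrix : Prop := {
  borcherds_real : forall i j, val (a i j) \is Num.real;
  borcherds_sym : forall i j, a i j = a j i;
  borcherds_npos : forall i j, i != j -> val (a i j) <= 0;
  borcherds_int : forall i j, 0 < val (a i i) ->
    exists m : int, 2 * a i j / a i i = m%:~R }.

Definition posJ : pred I := fun i => 0 < val (a i i).

Let term := lie_term K (borcherds_gen I).
Let h i : term := LGen (BH i).
Let e i : term := LGen (BE i).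
Let f i : term := LGen (BF i).

(* In the Serre relations [m] is the natural number [- 2 a_ij / a_ii]. *)
Variant borcherds_rel : term -> term -> Prop :=
| br_hh i j : borcherds_rel (LBr (h i) (h j)) LZero
| br_he i k : borcherds_rel (LBr (h i) (e k)) (LScale (a i k) (e k))
| br_hf i k : borcherds_rel (LBr (h i) (f k)) (LScale (- a i k) (f k))
| br_ef i j : borcherds_rel (LBr (e i) (f j)) (if i == j then h i else LZero)
| br_serre_e i j (m : nat) : i != j -> posJ i -> m%:R = - (2 * a i j / a i i) ->
    borcherds_rel (iter m.+1 (LBr (e i)) (e j)) LZero
| br_serre_f i j (m : nat) : i != j -> posJ i -> m%:R = - (2 * a i j / a i i) ->
    borcherds_rel (iter m.+1 (LBr (f i)) (f j)) LZero
| br_ee i j : a i j = 0 -> borcherds_rel (LBr (e i) (e j)) LZero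
| br_ff i j : a i j = 0 -> borcherds_rel (LBr (f i) (f j)) LZero.

Definition borcherds := lie_pres borcherds_rel.
HB.instance Definition _ := GRing.Lmodule.on borcherds.

Definition gh (i : I) : borcherds := lie_gen (BH i).
Definition ge (i : I) : borcherds := lie_gen (BE i).
Definition gf (i : I) : borcherds := lie_gen (BF i).

Local Notation br := (@lie_br _ _ borcherds_rel).

(** ** Root lattice, grading, real roots *)

Definition root_lattice : Type := {malg int[I]}.
HB.instance Definition _ := GRing.Zmodule.on root_lattice.

Definition alpha (i : I) : root_lattice := << 1 *g i >>.

Definition root_form (b c : root_lattice) : K :=
  \sum_(i <- msupp b) \sum_(j <- msupp c) (b@_i * c@_j)%:~R * a i j.

(* [has_degree b x]: [x] belongs to the homogeneous component of degree [b] *)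
Inductive has_degree : root_lattice -> borcherds -> Prop :=
| hd_h i : has_degree 0 (gh i)
| hd_e i : has_degree (alpha i) (ge i)
| hd_f i : has_degree (- alpha i) (gf i)
| hd_zero b : has_degree b 0
| hd_lin b c x y :
    has_degree b x -> has_degree b y -> has_degree b (c *: x + y)
| hd_br b c x y :
    has_degree b x -> has_degree c y -> has_degree (b + c) (br x y).

Definition is_reflection (j : I) (s : root_lattice -> root_lattice) : Prop :=
  forall b, exists c : int, c%:~R = 2 * root_form b (alpha j) / a j j /\
    s b = b - alpha j *~ c.

Definition weyl_group : set (root_lattice -> root_lattice) :=
  group_closure [set s | exists j, posJ j /\ is_reflection j s].

Definition real_root : set root_lattice :=
  [set b | exists w j, [/\ weyl_group w, posJ j & b = w (alpha j)]].

(** ** The subalgebras [gJ], [nJm] and the [gJ]-module [V'] *)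

Definition gJ : set borcherds :=
  lie_closure br [set x | exists j, posJ j /\ (x = ge j \/ x = gf j)].

Definition nJm : set borcherds :=
  lie_closure br [set x | exists j, posJ j /\ x = gf j].

Definition nonJ : Type := {i : I | ~~ posJ i}.

Definition UnJ_gf (i : nonJ) : set borcherds :=
  env_orbit (nJm : set (lie_pres borcherds_rel)) (gf (val i)).

Definition Vprime_pred : pred (nonJ -> borcherds) := fun v =>
  `[< (forall i, UnJ_gf i (v i)) /\ finite_set [set i | v i <> 0] >].

Lemma Vprime_closed : subsemimod_closed Vprime_pred.
Proof.
split; first split.
- apply/asboolP; split=> [i|]; first exact: env_orbit0.
  by apply: (sub_finite_set _ (finite_set0 _)) => i /= /(_ erefl).
- move=> v w /asboolP[v1 v2] /asboolP[w1 w2]; apply/asboolP; split=> [i|].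
    by have := env_orbit_lin 1 (v1 i) (w1 i); rewrite scale1r.
  apply: (sub_finite_set (B := [set i | v i <> 0] `|` [set i | w i <> 0])).
    move=> i /= vw; have [v0|] := eqVneq (v i) 0; last by move/eqP; left.
    by right=> w0; apply: vw; rewrite /= {1}/GRing.add /= v0 w0 addr0.
  by rewrite finite_setU.
- move=> c v /asboolP[v1 v2]; apply/asboolP; split=> [i|].
    by have := env_orbit_lin c (v1 i) (env_orbit0 _ _); rewrite addr0.
  apply: (sub_finite_set _ v2) => i /= cv v0; apply: cv.
  by rewrite /= {1}/GRing.scale /= v0 scaler0.
Qed.
HB.instance Definition _ := GRing.isSubmodClosed.Build K (nonJ -> borcherds)
  Vprime_pred Vprime_closed.

(* The external direct sum of the [UnJ_gf i], as families of finite support. *)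
Record Vprime : Type := MkVprime {
  Vprime_val :> nonJ -> borcherds;
  _ : Vprime_pred Vprime_val }.
HB.instance Definition _ := [isSub for Vprime_val].
HB.instance Definition _ := gen_eqMixin Vprime.
HB.instance Definition _ := gen_choiceMixin Vprime.
HB.instance Definition _ := [SubChoice_isSubLmodule of Vprime by <:].

(** ** The action of [gJ] on [V'] *)

Lemma relE s t : borcherds_rel s t ->
  lie_pi borcherds_rel s = lie_pi borcherds_rel t.
Proof. by move=> st; apply/lie_piP/le_rel. Qed.

Lemma br_h_f i k : br (gh i) (gf k) = - a i k *: gf k.
Proof. by rewrite lie_brE -lie_piZ; apply/relE; constructor. Qed.

Lemma br_e_f i j : br (ge i) (gf j) = if i == j then gh i else 0.
Proof.
by rewrite lie_brE (relE (br_ef i j)); case: eqP.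
Qed.

Section Stability.
Variable i : nonJ.

Inductive gf_words : borcherds -> Prop :=
| gw_f : gf_words (gf (val i))
| gw_0 : gf_words 0
| gw_lin c x y : gf_words x -> gf_words y -> gf_words (c *: x + y)
| gw_br j x : posJ j -> gf_words x -> gf_words (br (gf j) x).

Lemma gwD x y : gf_words x -> gf_words y -> gf_words (x + y).
Proof. by move=> wx wy; rewrite -[x]scale1r; apply: gw_lin. Qed.
Lemma gwZ c x : gf_words x -> gf_words (c *: x).
Proof. by move=> wx; rewrite -[_ *: _]addr0; apply: gw_lin => //; exact: gw_0. Qed.

Lemma gw_h k x : gf_words x -> gf_words (br (gh k) x).
Proof.
elim=> {x} [||c x y _ IHx _ IHy|j x Jj wx IHx].
- by rewrite br_h_f; apply/gwZ/gw_f.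
- by rewrite lie_br0; exact: gw_0.
- by rewrite lie_brDr lie_brZr; apply: gw_lin.
- rewrite lie_br_der br_h_f lie_brZl.
  by apply: gwD; [apply/gwZ/gw_br | apply/gw_br].
Qed.

Lemma gw_e k x : posJ k -> gf_words x -> gf_words (br (ge k) x).
Proof.
move=> Jk; elim=> {x} [||c x y _ IHx _ IHy|j x Jj wx IHx].
- rewrite br_e_f; case: eqP => [ki|_]; last exact: gw_0.
  by case: i ki Jk => /= i' /negbTE i'J ->; rewrite i'J.
- by rewrite lie_br0; exact: gw_0.
- by rewrite lie_brDr lie_brZr; apply: gw_lin.
- rewrite lie_br_der br_e_f; apply: gwD; last exact: gw_br.
  by case: eqP => _; [exact: gw_h | rewrite lie_0br; exact: gw_0].
Qed.

Lemma gw_closure (X : set borcherds) x y :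
  (forall z w, X z -> gf_words w -> gf_words (br z w)) ->
  lie_closure br X x -> gf_words y -> gf_words (br x y).
Proof.
move=> HX Xx; elim: Xx y => {x} [x Xx||c x z _ IHx _ IHz|x z _ IHx _ IHz] y wy.
- exact: HX.
- by rewrite lie_0br; exact: gw_0.
- by rewrite lie_brDl lie_brZl; apply: gw_lin; auto.
- have -> : br (br x z) y = br x (br z y) - br z (br x y).
    by rewrite lie_br_der addrK.
  by rewrite -scaleN1r addrC; apply: gw_lin; auto.
Qed.

Lemma gw_gJ x y : gJ x -> gf_words y -> gf_words (br x y).
Proof.
apply: gw_closure => z w [j [Jj [->|->]]] ww; first exact: gw_e.
exact: gw_br.
Qed.

Lemma gw_nJm x y : nJm x -> gf_words y -> gf_words (br x y).
Proof. by apply: gw_closure => z w [j [Jj ->]]; exact: gw_br. Qed.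

Lemma UnJ_gfE x : UnJ_gf i x <-> gf_words x.
Proof.
split=> [/env_orbitP[t ->]|].
  have : gf_words (gf (val i)) by exact: gw_f.
  elim: t (gf _) => [y||s IHs t IHt|c s IHs||s IHs t IHt] v wv //=.
  - by apply: gw_nJm => //; exact: set_mem (valP y).
  - exact: gw_0.
  - by apply: gwD; auto.
  - by apply: gwZ; auto.
  - by auto.
elim=> {x} [||c x y _ IHx _ IHy|j x Jj _ /env_orbitP[t ->]].
- by apply/env_orbitP; exists AOne.
- exact: env_orbit0.
- exact: env_orbit_lin.
- have nj : gf j \in (nJm : set (lie_pres borcherds_rel)).
    by apply: mem_set; apply: lc_gen; exists j.
  by apply/env_orbitP; exists (AMul (AGen (exist _ (gf j) nj)) t).
Qed.

End Stability.

Lemma UnJ_gf_stable i x y : gJ x -> UnJ_gf i y -> UnJ_gf i (br x y).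
Proof. by move=> gx /UnJ_gfE wy; apply/UnJ_gfE/gw_gJ. Qed.

Lemma gJ_act_subproof (x : gJ) (v : Vprime) :
  Vprime_pred (fun i => br (val x) (v i)).
Proof.
have gx : gJ (val x) by exact: set_mem (valP x).
case: v => v /= /asboolP[v1 v2]; apply/asboolP; split=> [i|].
  exact: UnJ_gf_stable.
by apply: (sub_finite_set _ v2) => i /= xv v0; apply: xv; rewrite v0 lie_br0.
Qed.

Definition gJ_act (x : gJ) (v : Vprime) : Vprime :=
  MkVprime (gJ_act_subproof x v).

Lemma gJ_act_linear x : linear (gJ_act x).
Proof.
move=> c v w; apply: val_inj; apply/funext => i /=.
by change (br (val x) (c *: v i + w i) = c *: br (val x) (v i) + br (val x) (w i));
  rewrite lie_brDr lie_brZr.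
Qed.
HB.instance Definition _ x :=
  GRing.isLinear.Build K Vprime Vprime *:%R (gJ_act x) (gJ_act_linear x).

Definition gJ_pi (x : gJ) : tensor Vprime -> tensor Vprime :=
  tensor_der (gJ_act x).

(** ** The Kac-Moody group [GJ], inside the linear group of [T(V')] *)

(* Root vectors for real roots act locally nilpotently, so that each of them
   has an exponential in the sense of [is_exp].  The quotient of the free
   product of the root spaces by the kernel of its representation on [T(V')]
   is the group generated by these exponentials. *)
Definition root_exponentials : set (tensor Vprime -> tensor Vprime) :=
  [set g | exists b (x : gJ),
    [/\ real_root b, has_degree b (val x) & is_exp (gJ_pi x) g]].

Definition GJ : set (tensor Vprime -> tensor Vprime) :=
  group_closure root_exponentials.

End Borcherds.

Arguments borcherds_matrix {R P K I}.
Arguments posJ {R P K I}.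
Arguments Vprime {R P K I}.
Arguments GJ {R P K I}.

(* Main.v *)
From HB Require Import structures.
From mathcomp Require Import all_boot all_order all_algebra.
From mathcomp Require Import boolp classical_sets functions reals complex.
From mathcomp Require Import finmap monalg.
Require Import Defs.
Import GRing.Theory Num.Theory.
Local Open Scope classical_set_scope.
Local Open Scope ring_scope.

(** The Magnus group attached to a basis [S] of a vector space [V] depends on [S]
  only through a choice of coordinates.  A basis identifies the tensor algebra
  of [V] with the free associative algebra on [S] ([Psi_invK], [PsiK]), and so
  two bases give an algebra isomorphism [rebase] from [free_alg S1] onto
  [free_alg S2].  On the variables it is a linear change of variables: the
  variable [s] goes to the linear form that expresses the vector [s] in the
  basis [S2].  It therefore preserves word length ([homog_rebase]) and the free
  Lie algebra ([free_lie_rebase]).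

  Applied in each degree, [rebase] acts on formal series, and as it respects
  products it commutes with the exponential ([series_rebase_exp]); hence it maps
  one Magnus group onto the other.  A transformation [g] of the tensor
  algebra acts on both sides through the identification of the tensor algebra
  with the free algebra, so [rebase] intertwines the two actions for a trivial
  reason ([series_rebase_act]).  The pair [(rebase, id)] is then an isomorphism
  of the semi-direct products with a common second factor
  ([semidirect_basis_isomorphic]), here the Kac-Moody group acting on the tensor
  algebra of [Vprime]. *)

(** * Linear maps out of a space of finitely supported functions *)

Section LinearExtension.
Context {K : fieldType} {X : choiceType} {W : lmodType K}.
Variable h : X -> W.

(** Both [lincomb] and [Psi_inv] are instances of this extension of a map from
  basis elements to vectors. *)
Definition malg_ext (c : {malg K[X]}) : W :=
  \sum_(x <- msupp c) c@_x *: h x.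

(** Sums with different supports become comparable over a common finite set,
  which is how linearity is obtained. *)
Lemma malg_extEw {D : {fset X}} {c : {malg K[X]}} :
  (msupp c `<=` D)%fset -> malg_ext c = \sum_(x <- D) c@_x *: h x.
Proof.
move=> cD; rewrite /malg_ext (big_fset_incl _ cD) //= => x _ xc.
by rewrite mcoeff_outdom ?scale0r.
Qed.

Lemma malg_ext_linear : linear malg_ext.
Proof.
move=> k c d; set D := (msupp c `|` msupp d)%fset.
have cD : (msupp c `<=` D)%fset by exact: fsubsetUl.
have dD : (msupp d `<=` D)%fset by exact: fsubsetUr.
have kD : (msupp (k *: c + d) `<=` D)%fset.
  apply: fsubset_trans (msuppD_le _ _) _.
  by rewrite fsubUset dD (fsubset_trans (msuppZ_le _ _) cD).
rewrite (malg_extEw kD) (malg_extEw cD) (malg_extEw dD) scaler_sumr -big_split.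
by apply: eq_bigr => x _ /=; rewrite mcoeffD mcoeffZ scalerDl scalerA.
Qed.
HB.instance Definition _ :=
  GRing.isLinear.Build K {malg K[X]} W *:%R malg_ext malg_ext_linear.

Lemma malg_extU x : malg_ext << x >> = h x.
Proof.
by rewrite (malg_extEw (msuppU_le (x := 1))) big_seq_fset1 mcoeffUU scale1r.
Qed.

End LinearExtension.

Section MalgLinear.
Context {K : fieldType}.

Lemma malgUZ {X : choiceType} c (x : X) : << c *g x >> = c *: << x >> :> {malg K[X]}.
Proof. by apply/malgP => k; rewrite mcoeffZ !mcoeffU mulr_natr. Qed.

Lemma malg_idE {X : choiceType} (c : {malg K[X]}) :
  c = \sum_(x <- msupp c) c@_x *: << x >>.
Proof. by rewrite {1}[c]monalgE; apply: eq_bigr => x _; rewrite malgUZ. Qed.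

Context {M : monomType}.
Implicit Types u v : {malg K[M]}.

Lemma malg_mulE u v : u * v = \sum_(x <- msupp u) \sum_(y <- msupp v)
  (u@_x * v@_y) *: << mmul x y >>.
Proof.
by rewrite malgME; apply: eq_bigr => x _; apply: eq_bigr => y _; rewrite malgUZ.
Qed.

(** Scalars are central, so that the left algebra of finitely supported functions
  on a monoid is an algebra; noncommutativity of the monoid is harmless because
  the coefficients commute. *)
Lemma malg_scalerAr (c : K) u v : c *: (u * v) = u * (c *: v).
Proof.
apply/malgP => k; rewrite mcoeffZ mcoeffMl (mcoeffMlw _ (fsubset_refl _) (msuppZ_le c v)).
rewrite mulr_sumr; apply: eq_bigr => x _; rewrite mulr_sumr.
by apply: eq_bigr => y _; rewrite mulrnAr mcoeffZ mulrCA.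
Qed.

End MalgLinear.

(** * The tensor algebra and the free algebra on a basis *)

Section TensorAlgebra.
Context {K : fieldType} {V : lmodType K}.

Lemma tensor_in_linear : linear (@tensor_in K V).
Proof.
move=> c v w; rewrite /tensor_in /alg_gen -alg_piZ -alg_piD.
exact/alg_piP/ae_rel.
Qed.
HB.instance Definition _ := GRing.isLinear.Build K V (tensor V) *:%R
  (@tensor_in K V) tensor_in_linear.

Lemma tensor_scaleM (a b : K) (x y : tensor V) :
  (a *: x) * (b *: y) = (a * b) *: (x * y).
Proof. by rewrite -scalerA [b *: (x * y)]alg_scalerAr [RHS]alg_scalerAl. Qed.

End TensorAlgebra.

Section PsiInverse.
Context {K : fieldType} {V : lmodType K} {S : set V}.

Let word_tensor (w : {fmonom S}) : tensor V :=
  \prod_(s <- (w : seq S)) tensor_in (val s).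

(** [Psi_inv] is the algebra morphism out of the free algebra that maps the variable
  of [s] to the vector [s]. *)
Lemma Psi_inv_linear : linear (@Psi_inv K V S).
Proof. exact: (malg_ext_linear word_tensor). Qed.
HB.instance Definition _ := GRing.isLinear.Build K (free_alg S) (tensor V) *:%R
  (@Psi_inv K V S) Psi_inv_linear.

Lemma Psi_inv_word (w : {fmonom S}) :
  Psi_inv (<< w >> : free_alg S) = \prod_(s <- (w : seq S)) tensor_in (val s).
Proof. exact: (malg_extU word_tensor). Qed.

Lemma Psi_inv_fvar (s : S) : Psi_inv (fvar s) = tensor_in (val s).
Proof. by rewrite Psi_inv_word fmU big_seq1. Qed.

Lemma Psi_inv1 : Psi_inv (1 : free_alg S) = 1.
Proof. by rewrite [LHS]Psi_inv_word fm1 big_nil. Qed.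

Lemma Psi_invM (u v : free_alg S) : Psi_inv (u * v) = Psi_inv u * Psi_inv v.
Proof.
rewrite [u * v]malg_mulE raddf_sum /= mulr_suml.
apply: eq_bigr => w _; rewrite raddf_sum /= mulr_sumr.
apply: eq_bigr => w' _; rewrite linearZ /= Psi_inv_word fmM big_cat /=.
exact/esym/tensor_scaleM.
Qed.

End PsiInverse.

Section Coordinates.
Context {K : fieldType} {V : lmodType K} {S : set V}.
Hypothesis S_basis : is_basis S.

Lemma coordK v : lincomb (coord S v) = v.
Proof. by rewrite /coord; case: xgetP => // /(_ _) n; case: (S_basis.2 v) => c /n. Qed.

Lemma lincombK c : coord S (lincomb c) = c.
Proof.
apply/eqP; rewrite -subr_eq0; apply/eqP/S_basis.1.
by rewrite [lincomb _](raddfB (malg_ext val)) [X in X - _]coordK subrr.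
Qed.

Lemma lincomb_linear : linear (@lincomb K V S).
Proof. exact: malg_ext_linear. Qed.

Lemma coord_linear : linear (coord S).
Proof. by move=> k v w; rewrite -[RHS]lincombK lincomb_linear !coordK. Qed.

Lemma coord_val (s : S) : coord S (val s) = << s >>.
Proof. by rewrite -[RHS]lincombK; congr coord; rewrite [RHS]malg_extU. Qed.

(** The one relation to check beyond the algebra axioms is that the generators of
  the tensor algebra depend linearly on the vector: this is linearity of
  coordinates, hence the need for a basis. *)
Lemma Psi_term_eq s t : alg_eq (@tensor_rel K V) s t ->
  Psi_term S s = Psi_term S t.
Proof.
elim=> {s t} /=.
- move=> _ _ [c v w] /=; rewrite coord_linear.
  exact: (linearP (malg_ext (@fvar K V S))).
- by [].
- by [].
- by move=> s t u _ -> _ ->.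
- by move=> s s' t t' _ -> _ ->.
- by move=> c s s' _ ->.
- by move=> s s' t t' _ -> _ ->.
- by move=> s t u; rewrite addrA.
- by move=> s t; rewrite addrC.
- by move=> s; rewrite add0r.
- by move=> s; rewrite scaleN1r addNr.
- by move=> c d s; rewrite scalerA.
- by move=> s; rewrite scale1r.
- by move=> c s t; rewrite scalerDr.
- by move=> c d s; rewrite scalerDl.
- by move=> s t u; rewrite mulrA.
- by move=> s; rewrite mul1r.
- by move=> s; rewrite mulr1.
- by move=> s t u; rewrite mulrDl.
- by move=> s t u; rewrite mulrDr.
- by move=> c s t; rewrite -scalerAl.
- by move=> c s t; rewrite -malg_scalerAr.
Qed.

Lemma PsiE t : Psi S (alg_pi (@tensor_rel K V) t) = Psi_term S t.
Proof. exact/Psi_term_eq/alg_piK. Qed.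

Lemma Psi_linear : linear (Psi S).
Proof.
move=> c x y; have [s ->] := alg_pi_ex x; have [t ->] := alg_pi_ex y.
by rewrite -alg_piZ -alg_piD !PsiE.
Qed.

HB.instance Definition _ := GRing.isLinear.Build K (tensor V) (free_alg S) *:%R
  (Psi S) Psi_linear.

Lemma PsiM x y : Psi S (x * y) = Psi S x * Psi S y.
Proof.
have [s ->] := alg_pi_ex x; have [t ->] := alg_pi_ex y.
by rewrite -alg_piM !PsiE.
Qed.

Lemma Psi1 : Psi S 1 = 1. Proof. by rewrite -alg_pi1 PsiE. Qed.

Lemma Psi_in v : Psi S (tensor_in v) = malg_ext (@fvar K V S) (coord S v).
Proof. by rewrite /tensor_in /alg_gen PsiE. Qed.

Lemma Psi_in_val (s : S) : Psi S (tensor_in (val s)) = fvar s.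
Proof. by rewrite Psi_in coord_val malg_extU. Qed.

Lemma Psi_prod (w : seq S) :
  Psi S (\prod_(s <- w) tensor_in (val s)) = << FMonom w >>.
Proof.
elim: w => [|s w IHw]; first by rewrite big_nil Psi1 -fmoneE.
rewrite big_cons PsiM Psi_in_val IHw.
rewrite [LHS]malgM_def [LHS]fgmulUU mulr1; congr mkmalgU.
by apply/eqP; rewrite fmP fmM fmU.
Qed.

(** It suffices to look at words, which span the free algebra. *)
Lemma Psi_invK : cancel (@Psi_inv K V S) (Psi S).
Proof.
move=> u; rewrite raddf_sum /= [RHS]malg_idE; apply: eq_bigr => w _.
by rewrite linearZ /= Psi_prod fmK.
Qed.

(** Both maps respect the algebra operations, so the identity has to be checked
  on generators only, where it says that a vector is the combination of basis
  vectors given by its coordinates. *)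
Lemma PsiK : cancel (Psi S) (@Psi_inv K V S).
Proof.
move=> x; have [t ->] := alg_pi_ex x; rewrite PsiE.
elim: t => [v||s IHs t IHt|c s IHs||s IHs t IHt] /=.
- rewrite raddf_sum -[in RHS](coordK v).
  rewrite -[RHS]/(tensor_in (lincomb (coord S v))) raddf_sum.
  by apply: eq_bigr => s _; rewrite [RHS]linearZ [LHS]linearZ /= Psi_inv_fvar.
- by rewrite raddf0.
- by rewrite raddfD /= IHs IHt alg_piD.
- by rewrite linearZ /= IHs alg_piZ.
- exact: Psi_inv1.
- by rewrite Psi_invM IHs IHt alg_piM.
Qed.

End Coordinates.

(** * Homogeneous elements *)

Section Homogeneous.
Context {K : fieldType} {V : lmodType K} {S : set V}.
Implicit Types u v : free_alg S.

Lemma homog0 n : homog n (0 : free_alg S).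
Proof. by move=> w; rewrite msupp0. Qed.

Lemma homog_lin n (c : K) u v : homog n u -> homog n v -> homog n (c *: u + v).
Proof.
move=> hu hv w /(fsubsetP (msuppD_le _ _)); rewrite in_fsetU => /orP[].
  by move/(fsubsetP (msuppZ_le _ _))/hu.
exact: hv.
Qed.

Lemma homogM m n u v : homog m u -> homog n v -> homog (m + n) (u * v).
Proof. by move=> hu hv w /msuppM_le[x [y [/hu xm /hv yn ->]]]; rewrite fdegM xm yn. Qed.

Lemma homog1 : homog 0 (1 : free_alg S).
Proof. by move=> w; rewrite msuppU1 in_fset1 => /eqP->; rewrite fdeg1. Qed.

Lemma homog_fvar (s : S) : homog 1 (fvar s).
Proof. by move=> w; rewrite msuppU1 in_fset1 => /eqP->; rewrite fdegU. Qed.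

Lemma homog_sum n I (r : seq I) (P : pred I) (c : I -> K) (F : I -> free_alg S) :
  (forall i, P i -> homog n (F i)) -> homog n (\sum_(i <- r | P i) c i *: F i).
Proof.
move=> hF; elim/big_rec: _ => [|i u Pi hu]; first exact: homog0.
by apply: homog_lin => //; apply: hF.
Qed.

End Homogeneous.

(** * Change of basis *)

Section ChangeOfBasis.
Context {K : fieldType} {V : lmodType K} {S1 S2 : set V}.
Hypotheses (S1_basis : is_basis S1) (S2_basis : is_basis S2).
Implicit Types u v : free_alg S1.

Definition rebase (u : free_alg S1) : free_alg S2 := Psi S2 (Psi_inv u).

Lemma rebase_linear : linear rebase.
Proof. by move=> c u v; rewrite /rebase linearP; exact: Psi_linear. Qed.
HB.instance Definition _ := GRing.isLinear.Build K (free_alg S1) (free_alg S2) *:%R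
  rebase rebase_linear.

Lemma rebaseZ c u : rebase (c *: u) = c *: rebase u.
Proof. exact: linearZ. Qed.

Lemma rebase1 : rebase 1 = 1.
Proof. by rewrite /rebase Psi_inv1 Psi1. Qed.

Lemma rebaseM u v : rebase (u * v) = rebase u * rebase v.
Proof. by rewrite /rebase Psi_invM PsiM. Qed.

Lemma rebase_fvar s : rebase (fvar s) = malg_ext (@fvar K V S2) (coord S2 (val s)).
Proof. by rewrite /rebase Psi_inv_fvar Psi_in. Qed.

(** An algebra morphism respects commutators, and the image of a variable is a
  linear combination of variables. *)
Lemma free_lie_rebase u : free_lie u -> free_lie (rebase u).
Proof.
elim=> {u} [_ [s _ <-]||c u v _ hu _ hv|u v _ hu _ hv].
- rewrite rebase_fvar /malg_ext; elim/big_rec: _ => [|t u _ hu]; first exact: lc_zero.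
  by apply: lc_lin => //; apply: lc_gen; exists t.
- by rewrite (raddf0 rebase); exact: lc_zero.
- by rewrite rebase_linear; exact: lc_lin.
- have -> : rebase (u * v - v * u) = rebase u * rebase v - rebase v * rebase u.
    by rewrite [LHS]raddfB; congr (_ - _); exact: rebaseM.
  exact: lc_br.
Qed.

(** A word of length [n] goes to a product of [n] linear forms. *)
Lemma homog_rebase n u : homog n u -> homog n (rebase u).
Proof.
move=> hu; rewrite /rebase /Psi_inv raddf_sum /= big_seq.
under eq_bigr => w _ do rewrite linearZ /=.
apply: homog_sum => w /hu <- {n u hu}.
rewrite /fdeg; elim: (w : seq S1) => [|s t IHt].
  by rewrite big_nil Psi1 //; exact: homog1.
rewrite big_cons PsiM //; apply: (homogM 1 _ _ _ _ IHt).
by rewrite Psi_in //; apply: homog_sum => x _; exact: homog_fvar.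
Qed.

Definition series_rebase (u : series S1) : series S2 := fun n => rebase (u n).

Lemma completed_lie_rebase (u : series S1) : completed_lie u -> completed_lie (series_rebase u).
Proof.
move=> [u0 hu]; split=> [|n /hu[lu homu]]; first by rewrite /series_rebase u0 raddf0.
by split; [exact: free_lie_rebase | exact: homog_rebase].
Qed.

Lemma series_rebaseM (u v : series S1) :
  series_rebase (series_mul u v) = series_mul (series_rebase u) (series_rebase v).
Proof.
apply/funext => n; rewrite /series_rebase /series_mul raddf_sum.
by apply: eq_bigr => i _; exact: rebaseM.
Qed.

Lemma series_rebase_pow (u : series S1) k :
  series_rebase (series_pow u k) = series_pow (series_rebase u) k.
Proof.
elim: k => [|k IHk]; last by rewrite /series_pow !iterS series_rebaseM -/(series_pow u k) IHk.
apply/funext => n; rewrite /series_rebase /series_pow /= /series_one.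
by case: eqP => _; rewrite ?rebase1 ?raddf0.
Qed.

(** In each degree the exponential is a finite sum of powers, so no limit is
  involved. *)
Lemma series_rebase_exp (u : series S1) : series_rebase (series_exp u) = series_exp (series_rebase u).
Proof.
apply/funext => n; rewrite /series_rebase /series_exp (raddf_sum rebase).
by apply: eq_bigr => k _; rewrite /= rebaseZ -series_rebase_pow.
Qed.

Lemma magnus_rebase (u : series S1) : magnus_group u -> magnus_group (series_rebase u).
Proof.
move=> [v hv <-]; exists (series_rebase v); first exact: completed_lie_rebase.
by rewrite series_rebase_exp.
Qed.

(** The action on either side is [g] itself, transported from the tensor algebra,
  and [rebase] passes through the tensor algebra. *)
Lemma series_rebase_act g (u : series S1) :
  series_rebase (series_act g u) = series_act g (series_rebase u).
Proof.
by apply/funext => n; rewrite /series_rebase /series_act /rebase !PsiK.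
Qed.

End ChangeOfBasis.

(** * Isomorphism of the semi-direct products *)

Lemma series_rebaseK {K : fieldType} {V : lmodType K} (S1 S2 : set V) :
  is_basis S1 -> is_basis S2 ->
  cancel (@series_rebase K V S1 S2) (@series_rebase K V S2 S1).
Proof.
move=> b1 b2 u; apply/funext => n.
by rewrite /series_rebase /rebase PsiK // Psi_invK.
Qed.

(** The map is the change of basis on the Magnus group and the identity on [H];
  the reverse change of basis gives its inverse. *)
Theorem semidirect_basis_isomorphic {K : fieldType} {V : lmodType K}
    (S1 S2 : set V) (H : set (tensor V -> tensor V)) :
  is_basis S1 -> is_basis S2 ->
  isomorphic (semidirect S1 H) (semidirect_mul S1)
             (semidirect S2 H) (semidirect_mul S2).
Proof.
move=> b1 b2; exists (fun p => (series_rebase (S2 := S2) p.1, p.2)); split.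
  split.
  - by move=> p [p1 p2]; split=> //; exact: magnus_rebase.
  - apply: (can_in_inj (g := fun p => (series_rebase (S2 := S1) p.1, p.2))).
    by move=> [u g] _; rewrite /= series_rebaseK.
  - move=> [u g] [/= hu hg]; exists (series_rebase (S2 := S1) u, g).
      by split=> //; exact: magnus_rebase.
    by rewrite /= series_rebaseK.
move=> [u g] [v h] _ _; congr pair; rewrite /semidirect_mul [LHS]/=.
rewrite [LHS](series_rebaseM b2); congr series_mul.
exact: series_rebase_act.
Qed.

Theorem theorem3p5 (R : realType) (P : pred R[i]) (K : subFieldType P)
    (I : countType) (a : I -> I -> K)
    (a_borcherds : borcherds_matrix a)
    (a_neg : forall i j, ~~ posJ a i -> ~~ posJ a j -> i != j -> val (a i j) < 0)
    (S1 S2 : set (Vprime a))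
    (S1_basis : is_basis S1) (S2_basis : is_basis S2) (S12 : S1 <> S2) :
  isomorphic (semidirect S1 (GJ a)) (semidirect_mul S1)
             (semidirect S2 (GJ a)) (semidirect_mul S2).
Proof. exact: semidirect_basis_isomorphic. Qed.
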